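(* Let $I_1,\ldots,I_m$ be finite multisets of elements of $\mathcal I$. Then, in $\mathbb R[x^{\mathcal I}]$, $$x^{\diamond I_1}\cdots x^{\diamond I_m}=\sum_{(\pi,K)\in\mathcal D_{\mathrm{NF}}(I_1,\ldots,I_m)}\kappa[X]^\pi\,x^{\diamond K}.$$
   Context: Let $(X^i)_{i\in\mathcal I}$ be a collection of real random variables on a probability space, all of whose mixed moments are finite, and let $(x^i)_{i\in\mathcal I}$ be commuting indeterminates, generating the polynomial algebra $\mathbb R[x^{\mathcal I}]$. For a finite multiset $I=\{i_1,\ldots,i_n\}$ of elements of $\mathcal I$ put $x^I=x^{i_1}\cdots x^{i_n}$, and let $\kappa[X^I]=\kappa[X^{i_1},\ldots,X^{i_n}]$ be the joint cumulant. Elements of a multiset, counted with multiplicity, are treated as distinguishable nodes: sums over $J\subset I$ run over all $2^{|I|}$ subsets of nodes, and $\mathcal P(I)$ is the set of partitions of the set of nodes of $I$ into non-empty blocks ($\mathcal P(\varnothing)=\{\varnothing\}$). For a partition $\pi$ put $\kappa[X]^\pi=\prod_{J\in\pi}\kappa[X^J]$, with $\kappa[X]^\varnothing=1$; $|\pi|$ is the number of blocks. Appell polynomials: $x^{\diamond I}=\sum_{J\subset I}x^J\sum_{\pi\in\mathcal P(I\setminus J)}(-1)^{|\pi|}\kappa[X]^\pi$, with $x^{\diamond\varnothing}=1$. Diagrams: given rows $I_1,\ldots,I_m$, let $I=I_1\sqcup\cdots\sqcup I_m$ (disjoint union of nodes). A diagram is a pair $(\pi,K)$ with $K\subset I$ a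 subset of nodes and $\pi\in\mathcal P(I\setminus K)$. It is non-flat if no block of $\pi$ is contained in a single row ($K$ is allowed to lie in a single row). $\mathcal D_{\mathrm{NF}}(I_1,\ldots,I_m)$ is the set of non-flat diagrams. *)

(* Defs.v *)
From HB Require Import structures.
From mathcomp Require Import all_boot all_order all_algebra.
From mathcomp Require Import finmap multiset.
From mathcomp Require Import all_classical all_reals all_analysis.
(* monalg's notations and names clash with those of mathcomp-analysis, so only
   its canonical structures are imported. *)
From mathcomp Require monalg.
Import (canonicals) monalg.

Set Implicit Arguments.
Unset Strict Implicit.
Unset Printing Implicit Defensive.

Import GRing.Theory.
Local Open Scope ring_scope.

(* The polynomial algebra R[x^idx]: the monoid algebra over R of the free
   commutative monoid on idx (which may be infinite). *)
Definition polyalg (R : realType) (idx : choiceType) :=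
  monalg.malg (monalg.cmonom idx) R.

HB.instance Definition _ (R : realType) (idx : choiceType) :=
  GRing.ComAlgebra.on (polyalg R idx).

Definition indet (R : realType) (idx : choiceType) (i : idx) : polyalg R idx :=
  monalg.mkmalgU (monalg.ucm i) 1.

(* The nodes of a multiset M: the elements of M counted with multiplicity, i.e.
   the pairs of an element i of M and an index < M i. *)
Definition node (idx : choiceType) (M : {mset idx}%mset) : finType :=
  {i : finsupp M & 'I_(M (val i))}.

Definition label (idx : choiceType) (M : {mset idx}%mset) (v : node M) : idx :=
  val (tag v).

(* The nodes of the disjoint union of the rows M_0, ..., M_(m-1). *)
Definition unode (idx : choiceType) (m : nat) (M : 'I_m -> {mset idx}%mset) :
    finType :=
  {k : 'I_m & node (M k)}.

Definition ulabel (idx : choiceType) (m : nat) (M : 'I_m -> {mset idx}%mset)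
    (v : unode M) : idx :=
  label (tagged v).

Definition row_nodes (idx : choiceType) (m : nat)
    (M : 'I_m -> {mset idx}%mset) (k : 'I_m) : {set unode M} :=
  [set v | tag v == k].

Definition all_mixed_moments_finite (d : measure_display)
    (T : measurableType d) (R : realType) (P : probability T R)
    (idx : Type) (X : idx -> {RV P >-> R}) : Prop :=
  forall s : seq idx,
    P.-integrable [set: T] (fun w => (\prod_(i <- s) X i w)%:E).

Section Cumulant.
Context (d : measure_display) (T : measurableType d) (R : realType).
Context (P : probability T R) (V : finType) (Y : V -> {RV P >-> R}).

Definition moment (J : {set V}) : R :=
  fine 'E_P[fun w => \prod_(v in J) Y v w].

(* The joint cumulant of the random variables (Y v)_{v in J}, for J non-empty:
   the sum over the partitions pi of J of
   (-1)^(|pi|-1) (|pi|-1)! \prod_(B in pi) E[\prod_(v in B) Y v]. *)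
Definition cumulant (J : {set V}) : R :=
  \sum_(pi : {set {set V}} | finset.partition pi J)
    (-1) ^+ #|pi|.-1 * (#|pi|.-1)`!%:R * \prod_(B in pi) moment B.

Definition cumulant_prod (pi : {set {set V}}) : R :=
  \prod_(B in pi) cumulant B.

End Cumulant.

(* In the next definitions V is a finite set of nodes labelled by l in idx; a
   set of nodes A stands for the multiset of the labels of its elements. *)
Section Appell.
Context (d : measure_display) (T : measurableType d) (R : realType).
Context (P : probability T R) (idx : choiceType) (X : idx -> {RV P >-> R}).

Definition monomial (V : finType) (l : V -> idx) (A : {set V}) :
    polyalg R idx :=
  \prod_(v in A) indet R (l v).

Definition appell_nodes (V : finType) (l : V -> idx) (A : {set V}) :
    polyalg R idx :=
  \sum_(J in powerset A)
    (\sum_(pi : {set {set V}} | finset.partition pi (A :\: J))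
        (-1) ^+ #|pi| * cumulant_prod (fun v => X (l v)) pi)
      *: monomial l J.

Definition appell (M : {mset idx}%mset) : polyalg R idx :=
  appell_nodes (@label idx M) [set: node M].

End Appell.

Definition diagram (idx : choiceType) (m : nat) (M : 'I_m -> {mset idx}%mset)
    (D : {set {set unode M}} * {set unode M}) : bool :=
  finset.partition D.1 (~: D.2).

Definition nonflat (idx : choiceType) (m : nat) (M : 'I_m -> {mset idx}%mset)
    (D : {set {set unode M}} * {set unode M}) : bool :=
  [forall B in D.1, forall k : 'I_m, ~~ (B \subset row_nodes M k)].

(* Main.v *)
Require Import Defs.
From HB Require Import structures.
From mathcomp Require Import all_boot all_order all_algebra.
From mathcomp Require Import finmap multiset.
From mathcomp Require Import all_classical all_reals all_analysis.

Local Open Scope ring_scope.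

Import GRing.Theory fintype boot.finset.

(** The identity is a statement about exponentials of set functions.  For a
    set function [c] on the finite set of nodes, let [partition_sum c A] be the
    sum over the partitions of [A] of the product of [c] over the blocks.  This
    is the exponential of [c] for the convolution
    (a * b)(A) = sum over J in A of a(J) b(A \ J): it turns sums of set
    functions into convolutions ([partition_sumD]), and it factors over the
    rows when [c] vanishes on the blocks that lie in no single row
    ([partition_sum_fibers]).

    A monomial x^A is itself such an exponential, that of the set function x
    with x({v}) = x^v which vanishes on all sets that are not singletons
    ([monomialE]).  Write kappa for the cumulant as a set function.  The
    definition of the Appell polynomial, a convolution of monomials with the
    exponential of - kappa, then reads

      x^(<>A) = exp (x - kappa) (A)       ([appell_nodesE]).

    Split kappa as kappa_F + kappa_NF, its restrictions to the flat and to the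
    non-flat blocks.  The sum over the non-flat diagrams is the convolution of
    exp kappa_NF with exp (x - kappa), that is exp (x - kappa_F), evaluated at
    the set of all nodes.  Since singletons are flat, x - kappa_F vanishes on
    the non-flat blocks, so this exponential is the product over the rows of
    exp (x - kappa_F), and inside a row, where every block is flat, kappa_F is
    kappa: the factors are the Appell polynomials of the rows ([appellE]). *)

(** * Sums over partitions as exponentials of set functions *)

Section PartitionSum.
Context {V : finType} {R : comNzRingType}.
Implicit Types (a b c : {set V} -> R) (A B D S : {set V}).
Implicit Types (rho sigma tau : {set {set V}}).

Definition partition_sum c A : R :=
  \sum_(rho : {set {set V}} | partition rho A) \prod_(B in rho) c B.

Lemma eq_partition_sum a b A :
    (forall S, S != set0 -> S \subset A -> a S = b S) ->
  partition_sum a A = partition_sum b A.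
Proof.
move=> eq_ab; apply: eq_bigr => rho rho_A; apply: eq_bigr => B B_rho.
apply: eq_ab; first exact: partition_neq0 rho_A B_rho.
exact: partitionS rho_A B_rho.
Qed.

Lemma partition_sum0 c : partition_sum c set0 = 1.
Proof.
rewrite /partition_sum (big_pred1 set0) ?big_set0 //.
by move=> rho; rewrite /= partition_set0.
Qed.

Lemma partition_set1 rho (v : V) :
  partition rho [set v] = (rho == [set [set v]]).
Proof.
apply/idP/eqP => [rho_v|->]; last first.
  rewrite -[X in partition X _]setU0 -[X in partition _ X]setU0.
  apply: partitionU1; rewrite ?partition_set0 ?disjoints0 //.
    by rewrite -card_gt0 cards1.
  by rewrite -setI_eq0 setI0.
have sub_rho B : B \in rho -> B = [set v].
  move=> B_rho; have := partitionS rho_v B_rho.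
  by rewrite subset1 (negPf (partition_neq0 rho_v B_rho)) orbF => /eqP.
apply/setP => B; rewrite inE; apply/idP/eqP => [/sub_rho //|->].
have: v \in cover rho by rewrite (cover_partition rho_v) inE.
by case/bigcupP => C C_rho _; rewrite -(sub_rho C C_rho).
Qed.

Lemma partition_sum1 c (v : V) : partition_sum c [set v] = c [set v].
Proof.
rewrite /partition_sum (big_pred1 [set [set v]]) ?big_set1 //.
by move=> rho; rewrite /= partition_set1.
Qed.

(** A set that is not inside [D] has a point outside [D], and the block of a
    partition around that point kills the product. *)
Lemma partition_sum_eq0 c A D :
    (forall S, c S != 0 -> S \subset D) -> ~~ (A \subset D) ->
  partition_sum c A = 0.
Proof.
move=> c_D A_notD; apply: big1 => rho rho_A.
apply/eqP; apply: contraNT A_notD => prod_neq0.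
rewrite -(cover_partition rho_A); apply/bigcupsP => B B_rho; apply: c_D.
by apply: contraNneq prod_neq0 => c0; rewrite (bigD1 B) //= c0 mul0r.
Qed.

Lemma prod_add_subsets {I : finType} (F G : I -> R) (A : {set I}) :
  \prod_(i in A) (F i + G i) =
  \sum_(J in powerset A) (\prod_(i in J) F i) * \prod_(i in A :\: J) G i.
Proof.
(* The zero in F' discards the index sets J that are not subsets of A when the
   product over the whole type is expanded. *)
pose F' i := if i \in A then F i else 0.
pose G' i := if i \in A then G i else 1.
have -> : \prod_(i in A) (F i + G i) = \prod_i (F' i + G' i).
  rewrite big_mkcond; apply: eq_bigr => i _; rewrite /F' /G'.
  by case: ifP; rewrite ?add0r.
rewrite bigA_distr [RHS]big_mkcond; apply: eq_bigr => J _.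
rewrite powersetE; case: ifPn => [J_A|/subsetPn[i iJ iA]]; last first.
  by rewrite (bigD1 i) //= iJ /F' (negPf iA) mul0r.
rewrite (big_mkcond (fun i => i \in J)) (big_mkcond (fun i => i \in A :\: J)).
rewrite -big_split; apply: eq_bigr => i _; rewrite /F' /G' inE.
have [iJ|_] /= := boolP (i \in J); last by rewrite mul1r.
by rewrite (subsetP J_A) // mulr1.
Qed.

Lemma subset_partition rho sigma A :
  partition rho A -> sigma \subset rho -> partition sigma (cover sigma).
Proof.
case/and3P=> _ /trivIsetS ti n0 sub; rewrite /partition eqxx ti //=.
by apply: contra n0; apply: subsetP.
Qed.

Lemma partitionU {rho sigma A D} :
    partition rho A -> partition sigma D -> [disjoint A & D] ->
  partition (rho :|: sigma) (A :|: D).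
Proof.
move=> /and3P[/eqP <- ti n0] /and3P[/eqP <- ti' n0'] dis.
rewrite /partition /cover bigcup_setU eqxx inE negb_or n0 n0' andbT.
by rewrite trivIsetU.
Qed.

Lemma partitionD {rho sigma A} :
    partition rho A -> sigma \subset rho ->
  partition (rho :\: sigma) (A :\: cover sigma).
Proof.
move=> rho_A sub; have tau := subset_partition _ _ _ rho_A (subsetDl rho sigma).
suff <- : cover (rho :\: sigma) = A :\: cover sigma by [].
apply/setP => v; rewrite inE -(cover_partition rho_A).
apply/bigcupP/andP => [[B]|[v_sig /bigcupP[B B_rho vB]]].
  rewrite inE => /andP[B_sig B_rho] vB; split; last by apply/bigcupP; exists B.
  apply: contra B_sig => /bigcupP[C C_sig vC].
  have C_rho := subsetP sub _ C_sig.
  have ti := partition_trivIset rho_A.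
  by rewrite -(def_pblock ti B_rho vB) (def_pblock ti C_rho vC).
exists B => //; rewrite inE B_rho andbT; apply: contra v_sig => B_sig.
by apply/bigcupP; exists B.
Qed.

Lemma partitions_disjoint {rho sigma A D} :
    partition rho A -> partition sigma D -> [disjoint A & D] ->
  [disjoint rho & sigma].
Proof.
move=> rho_A sig_D dis; rewrite disjoints_subset; apply/subsetP => B B_rho.
rewrite inE; apply: contra (partition_neq0 rho_A B_rho) => B_sig.
rewrite -subset0 -(eqP (_ : A :&: D == set0)) ?setI_eq0 //.
by rewrite subsetI (partitionS rho_A B_rho) (partitionS sig_D B_sig).
Qed.

(** The exponential of a sum: expanding the product over the blocks splits a
    partition of [A] into the blocks that choose [a] and those that choose [b],
    and a pair of a partition and a subset of its blocks is the same thing as a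
    set [J] (the union of the chosen blocks), a partition of [J] and a
    partition of [A :\: J]. *)
Lemma partition_sumD a b A :
  partition_sum (fun S => a S + b S) A =
  \sum_(J in powerset A) partition_sum a J * partition_sum b (A :\: J).
Proof.
rewrite /partition_sum.
under eq_bigr do rewrite prod_add_subsets.
rewrite pair_big_dep /=.
rewrite (partition_big (fun p => cover p.2) [in powerset A]) /=; last first.
  move=> [rho sigma] /=; rewrite !powersetE => /andP[rho_A sub].
  rewrite -(cover_partition rho_A); apply/bigcupsP => B B_sig.
  by apply: (bigcup_max B) => //; apply: subsetP B_sig.
apply: eq_bigr => J; rewrite powersetE => J_A.
rewrite big_distrlr /= pair_big /=.
(* From the pairs (rho, sigma) with sigma a subset of rho whose union is J to the
   pairs (sigma, tau) with tau the other blocks of rho. *)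
rewrite (reindex_onto (fun p => (p.1 :|: p.2, p.1))
                      (fun p => (p.2, p.1 :\: p.2))) /=; last first.
  move=> [rho sigma] /= /andP[/andP[_]]; rewrite powersetE => sub _.
  by rewrite setDE setUIr setUCr setIT (setUidPr sub).
have dis_J : [disjoint J & A :\: J].
  by rewrite -setI_eq0 setIDA setDIl setDv set0I.
have split_pairE sigma tau :
    partition (sigma :|: tau) A && (sigma \in powerset (sigma :|: tau)) &&
      (cover sigma == J) && ((sigma, (sigma :|: tau) :\: sigma) == (sigma, tau))
    = partition sigma J && partition tau (A :\: J).
  rewrite powersetE subsetUl xpair_eqE eqxx andbT /=.
  apply/andP/andP => [[/andP[rho_A /eqP <-] /eqP tauE]|[sig_J tau_J]].
    have sub := subsetUl sigma tau.
    split; first exact: subset_partition rho_A sub.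
    by rewrite -{1}tauE; exact: partitionD.
  rewrite (cover_partition sig_J) eqxx andbT; split.
    by have := partitionU sig_J tau_J dis_J; rewrite -{1}(setIidPr J_A) setID.
  rewrite setDUl setDv set0U; apply/eqP/setDidPl; rewrite disjoint_sym.
  exact: partitions_disjoint sig_J tau_J dis_J.
apply: eq_big => [[sigma tau]|[sigma tau]] /=; first exact: split_pairE.
rewrite split_pairE => /andP[sig_J tau_J]; congr (_ * _).
apply: eq_bigl => B; rewrite !inE; case: (boolP (B \in sigma)) => //= B_sig.
by rewrite (disjointFr (partitions_disjoint sig_J tau_J dis_J) B_sig).
Qed.

(** If no block that counts straddles the boundary of [A], then [c] is the sum
    of its restriction to the subsets of [A] and of a function supported by the
    subsets of the complement, and a single term of the convolution of the two
    exponentials survives. *)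
Lemma partition_sum_saturated c A D :
    (forall S, c S != 0 -> (S \subset A) || [disjoint S & A]) -> A \subset D ->
  partition_sum c D = partition_sum c A * partition_sum c (D :\: A).
Proof.
move=> satA A_D.
pose cA S := if S \subset A then c S else 0.
pose cB S := if S \subset A then 0 else c S.
have cAE S : cA S != 0 -> S \subset A by rewrite /cA; case: ifP; rewrite ?eqxx.
have cBE S : cB S != 0 -> S \subset ~: A.
  rewrite /cB; case: ifPn; rewrite ?eqxx // => SA /satA.
  by rewrite (negPf SA) -disjoints_subset.
rewrite (@eq_partition_sum c (fun S => cA S + cB S)); last first.
  by move=> S _ _; rewrite /cA /cB; case: ifP; rewrite ?addr0 ?add0r.
rewrite partition_sumD (bigD1 A) ?powersetE //= [X in _ + X]big1 ?addr0.
  congr (_ * _); apply: eq_partition_sum => S S0.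
    by rewrite /cA => ->.
  rewrite subsetD /cB => /andP[_ dis]; case: ifP => // SA; case/negP: S0.
  by rewrite -(setIidPl SA) setI_eq0.
move=> J; rewrite powersetE => /andP[JD JA].
have [J_A|J_A] := boolP (J \subset A); last first.
  by rewrite (partition_sum_eq0 _ _ _ cAE J_A) mul0r.
rewrite (partition_sum_eq0 cB _ _ cBE) ?mulr0 //.
apply: contra JA => sub; rewrite eqEsubset J_A; apply/subsetP => v vA.
apply: contraLR (vA) => vJ.
by have := subsetP sub v; rewrite !inE vJ (subsetP A_D) //= => /(_ isT).
Qed.

(** A block inside one fiber is disjoint from all the others, so each fiber can
    be split off in turn. *)
Lemma partition_sum_fibers {K : finType} (f : V -> K) c (Q : {set K}) :
    (forall S, c S != 0 -> exists k, S \subset [set v | f v == k]) ->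
  partition_sum c [set v | f v \in Q] =
  \prod_(k in Q) partition_sum c [set v | f v == k].
Proof.
move=> c_fib; have [n] := ubnP #|Q|; elim: n Q => // n IHn Q.
have [->|[k kQ]] := set_0Vmem Q.
  rewrite big_set0 => _; rewrite (_ : [set v | _] = set0).
    exact: partition_sum0.
  by apply/setP => v; rewrite !inE.
rewrite (cardsD1 k) kQ ltnS => /IHn IH; rewrite (big_setD1 k) //= -IH.
rewrite (partition_sum_saturated c [set v | f v == k]); first last.
- by apply/subsetP => v; rewrite !inE => /eqP ->.
- move=> S /c_fib[j Sj]; have [<-|jk] := eqVneq j k; first by rewrite Sj.
  apply/orP; right; rewrite disjoints_subset; apply: (subset_trans Sj).
  by apply/subsetP => v; rewrite !inE => /eqP ->.
by congr (_ * partition_sum c _); apply/setP => v; rewrite !inE.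
Qed.

(** The fibers of the identity are the singletons, which have one partition. *)
Lemma partition_sum_singletons c A :
    (forall S, c S != 0 -> exists v, S \subset [set v]) ->
  partition_sum c A = \prod_(v in A) c [set v].
Proof.
move=> c1; have fibE (v : V) : [set u | id u == v] = [set v].
  by apply/setP => u; rewrite !inE.
transitivity (partition_sum c [set v | id v \in A]).
  by congr partition_sum; apply/setP => v; rewrite inE.
rewrite partition_sum_fibers => [|S /c1[v Sv]]; last by exists v; rewrite fibE.
by apply: eq_bigr => v _; rewrite fibE partition_sum1.
Qed.

End PartitionSum.

(** * Transport of partitions along an injection *)

Lemma big_partition_imset {R : Type} {idx : R} (op : Monoid.com_law idx)
    {V W : finType} (f : W -> V) (A : {set W}) (F : {set {set V}} -> R) :
    injective f ->
  \big[op/idx]_(rho : {set {set V}} | partition rho (f @: A)) F rho =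
  \big[op/idx]_(rho : {set {set W}} | partition rho A)
    F [set f @: (B : {set W}) | B in rho].
Proof.
move=> inj_f; have inj_im := imset_inj inj_f.
pose g (B : {set V}) := f @^-1: B.
have fK (B : {set W}) : g (f @: B) = B.
  by apply/setP => v; rewrite inE mem_imset.
rewrite (reindex_onto
    (fun rho : {set {set W}} => [set f @: (B : {set W}) | B in rho])
    (fun rho => [set g B | B in rho])).
  apply: eq_bigl => rho; rewrite imset_partition // -[RHS]andbT; congr (_ && _).
  apply/eqP; rewrite -imset_comp -[RHS]imset_id; apply: eq_imset => B.
  exact: fK.
move=> rho rho_A; rewrite -imset_comp -[RHS]imset_id.
apply: eq_in_imset => B B_rho /=; apply/setP => v; apply/imsetP/idP => [[w]|vB].
  by rewrite inE => wB ->.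
have /imsetP[w _ vE] := subsetP (partitionS rho_A B_rho) v vB.
by exists w => //; rewrite inE -vE.
Qed.

Lemma partition_sum_imset {V W : finType} {R : comNzRingType} (f : W -> V)
    (c : {set V} -> R) (A : {set W}) :
    injective f ->
  partition_sum c (f @: A) = partition_sum (fun B : {set W} => c (f @: B)) A.
Proof.
move=> inj_f; rewrite /partition_sum big_partition_imset //.
by apply: eq_bigr => rho _; rewrite big_imset // => B C _ _; exact: imset_inj.
Qed.

(** * Appell polynomials as exponentials *)

Section AppellNodes.
Context {d : measure_display} {T : measurableType d} {R : realType}.
Context {P : probability T R} {idx : choiceType} (X : idx -> {RV P >-> R}).

Lemma moment_imset {V W : finType} (f : W -> V) (Y : V -> {RV P >-> R})
    (J : {set W}) :
  injective f -> moment Y (f @: J) = moment (fun v => Y (f v)) J.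
Proof.
move=> inj_f; rewrite /moment; congr (fine 'E_P[_]); apply: funext => w.
by rewrite big_imset // => u v _ _; exact: inj_f.
Qed.

Lemma cumulant_imset {V W : finType} (f : W -> V) (Y : V -> {RV P >-> R})
    (J : {set W}) :
  injective f -> cumulant Y (f @: J) = cumulant (fun v => Y (f v)) J.
Proof.
move=> inj_f; have inj_im := imset_inj inj_f.
rewrite /cumulant big_partition_imset //; apply: eq_bigr => rho _.
rewrite card_imset // big_imset => [|B C _ _ ]; last exact: inj_im.
by congr (_ * _); apply: eq_bigr => B _; exact: moment_imset.
Qed.

(** The logarithm of the monomials, see [monomialE]. *)
Definition singleton_weight {V : finType} (l : V -> idx) (B : {set V}) :
    polyalg R idx :=
  if #|B| == 1%N then monomial R l B else 0.

Definition appell_weight {V : finType} (l : V -> idx) (B : {set V}) :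
    polyalg R idx :=
  singleton_weight l B - (cumulant (fun v => X (l v)) B)%:A.

Lemma cumulant_prodE {V : finType} (l : V -> idx) (rho : {set {set V}}) :
  (cumulant_prod (fun v => X (l v)) rho)%:A =
  \prod_(B in rho) (cumulant (fun v => X (l v)) B)%:A :> polyalg R idx.
Proof. exact: (rmorph_prod (in_alg (polyalg R idx))). Qed.

Lemma monomialE {V : finType} (l : V -> idx) (A : {set V}) :
  monomial R l A = partition_sum (singleton_weight l) A.
Proof.
rewrite partition_sum_singletons => [|S]; last first.
  rewrite /singleton_weight; case: ifP; last by rewrite eqxx.
  by move=> /cards1P[v ->] _; exists v.
apply: eq_bigr => v _.
by rewrite /singleton_weight cards1 eqxx /monomial big_set1.
Qed.

Lemma appell_nodesE {V : finType} (l : V -> idx) (A : {set V}) :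
  appell_nodes X l A = partition_sum (appell_weight l) A.
Proof.
rewrite /appell_weight partition_sumD; apply: eq_bigr => J _.
rewrite -monomialE -mulr_algl mulrC; congr (_ * _).
rewrite scaler_suml; apply: eq_bigr => rho _.
rewrite prodrN -cumulant_prodE -scalerA.
by rewrite -signr_odd scaler_sign -[in RHS]signr_odd mulr_sign.
Qed.

Lemma appell_nodes_imset {V W : finType} (f : W -> V) (l : V -> idx)
    (A : {set W}) :
    injective f ->
  appell_nodes X l (f @: A) = appell_nodes X (fun v => l (f v)) A.
Proof.
move=> inj_f.
rewrite appell_nodesE appell_nodesE (partition_sum_imset _ _ _ inj_f).
apply: eq_partition_sum => S _ _.
rewrite /appell_weight (cumulant_imset _ _ _ inj_f).
rewrite /singleton_weight (card_imset _ inj_f).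
case: ifP => // _; congr (_ - _).
by rewrite /monomial big_imset // => u v _ _; exact: inj_f.
Qed.

End AppellNodes.

(** The nodes of a single multiset are moved into the disjoint union of the
    rows, so that both sides of the identity are about one node set. *)
Lemma appellE {d : measure_display} {T : measurableType d} {R : realType}
    {P : probability T R} {idx : choiceType} (X : idx -> {RV P >-> R})
    {m : nat} (M : 'I_m -> {mset idx}%mset) (k : 'I_m) :
  appell X (M k) = appell_nodes X (@ulabel idx m M) (row_nodes M k).
Proof.
pose f (v : node (M k)) : unode M := Tagged (fun k => node (M k)) v.
have inj_f : injective f by move=> u v /eqP; rewrite eq_Tagged => /eqP.
suff -> : row_nodes M k = (f @: [set: node (M k)]).
  by rewrite appell_nodes_imset.
apply/setP => v; rewrite inE; apply/eqP/imsetP => [|[u _ ->]] //.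
by case: v => j v /= jk; move: v; rewrite jk => v; exists v; rewrite ?inE.
Qed.

(** * The product formula *)

Theorem theorem1p9 (d : measure_display) (T : measurableType d) (R : realType)
    (P : probability T R) (idx : choiceType) (X : idx -> {RV P >-> R})
    (hX : all_mixed_moments_finite X)
    (m : nat) (M : 'I_m -> {mset idx}%mset) :
  \prod_(k < m) appell X (M k) =
  \sum_(D : {set {set unode M}} * {set unode M} | diagram D && nonflat D)
    cumulant_prod (fun v => X (ulabel v)) D.1
      *: appell_nodes X (@ulabel idx m M) D.2.
Proof.
pose V : finType := unode M; pose l : V -> idx := @ulabel idx m M.
pose flat (B : {set V}) := [exists k, B \subset row_nodes M k].
pose kappa (B : {set V}) : polyalg R idx := (cumulant (fun v => X (l v)) B)%:A.
pose kappaNF B := if flat B then 0 else kappa B.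
pose w B := appell_weight X l B + kappaNF B.
(* w is x - kappa_F: subtracting kappa and adding kappa_NF leaves - kappa_F. *)
have w_flat B : flat B -> w B = appell_weight X l B.
  by rewrite /w /kappaNF => ->; rewrite addr0.
have w_row S : w S != 0 -> exists k, S \subset row_nodes M k.
  have [/existsP[k Sk] _|S_NF] := boolP (flat S); first by exists k.
  rewrite /w /kappaNF (negPf S_NF) /appell_weight subrK /singleton_weight.
  case: ifP => [/cards1P[v SE]|]; last by rewrite eqxx.
  by exists (tag v); rewrite SE sub1set inE.
transitivity (partition_sum w [set: V]).
  have -> : [set: V] = [set v : V | tag v \in [set: 'I_m]].
    by apply/setP => v; rewrite !inE.
  rewrite partition_sum_fibers //; apply: eq_big => k; rewrite ?inE // => _.
  rewrite appellE appell_nodesE; apply: eq_partition_sum => S _ S_k.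
  by rewrite w_flat //; apply/existsP; exists k.
rewrite /w partition_sumD.
transitivity (\sum_(K : {set V})
    \sum_(rho | partition rho (~: K) && nonflat (rho, K))
      cumulant_prod (fun v => X (l v)) rho *: appell_nodes X l K); last first.
  rewrite (exchange_big_dep xpredT) //= pair_big_dep /=.
  by apply: eq_big => [[rho K]|[rho K] _].
apply: eq_big => [K|K _]; first by rewrite powersetE subsetT.
rewrite setTD -appell_nodesE mulrC /partition_sum mulr_suml [RHS]big_mkcondr.
apply: eq_bigr => rho _; rewrite -mulr_algl cumulant_prodE.
have [NF|] := boolP (nonflat _).
  congr (_ * _); apply: eq_bigr => B B_rho; rewrite /kappaNF ifN //.
  rewrite negb_exists; apply/forallP => k.
  exact: (forallP (forall_inP NF B B_rho) k).
rewrite negb_forall_in => /exists_inP[B B_rho]; rewrite negb_forall => B_flat.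
rewrite (bigD1 B) //= {1}/kappaNF ifT ?mul0r //.
by apply/existsP; have /existsP[k] := B_flat; exists k; apply: negbNE.
Qed.
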